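(* Let $\mathcal{H}$ be a Hilbert space, let $A,B\in\mathcal{B}(\mathcal{H})$ be self-adjoint operators with spectra contained in the interval $J$, and let $f\in C^1_{\mathrm{co}}(J)$. If $A\le B$ and $f$ is increasing, then the number $$\gamma=\sup_{x\in\mathcal{H},\ \|x\|=1}\left\{\langle f'(B)Bx,x\rangle-\langle Ax,x\rangle\langle f'(B)x,x\rangle\right\}$$ is non-negative and satisfies $$f(B)\le f(A)+\gamma\,\mathbf{1}_{\mathcal{H}}.$$
   Context: $\mathcal{B}(\mathcal{H})$ is the $C^*$-algebra of bounded linear operators on a (complex) Hilbert space $\mathcal{H}$, with identity $\mathbf{1}_{\mathcal{H}}$. An operator $A$ is positive ($A\ge 0$) if $\langle Ax,x\rangle\ge 0$ for all $x\in\mathcal{H}$; for self-adjoint $A,B$, $A\le B$ means $B-A\ge 0$. $C^1_{\mathrm{co}}(J)$ denotes the class of differentiable convex real functions on the interval $J\subseteq\mathbb{R}$ (one-sided derivatives at endpoints belonging to $J$); $f'$ is the derivative of $f$. ''Increasing'' means $f'\ge 0$ on $J$. For a self-adjoint operator $T$ with spectrum in $J$, $f(T)$ and $f'(T)$ are defined by the continuous functional calculus. *)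

(* Defs.v *)
From HB Require Import structures.
From mathcomp Require Import all_boot all_order all_algebra.
From mathcomp Require Import sesquilinear.
From mathcomp Require Import complex.
From mathcomp Require Import all_classical all_reals all_analysis.

Set Implicit Arguments.
Unset Strict Implicit.
Unset Printing Implicit Defensive.

Import Order.TTheory GRing.Theory Num.Theory.
Import numFieldNormedType.Exports.

Local Open Scope classical_set_scope.
Local Open Scope ring_scope.
Local Open Scope complex_scope.

(* Complex Hilbert spaces.  [inner] is linear in its first argument and
   conjugate-linear in its second one. *)
HB.mixin Record CompleteNormedModule_isHilbert (R : realType) H
    & CompleteNormedModule R[i] H := {
  inner : {dot H for Num.conj};
  inner_normE : forall x : H, `|x| ^+ 2 = inner x x
}.

#[short(type="hilbertType")]
HB.structure Definition Hilbert (R : realType) :=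
  {H of CompleteNormedModule R[i] H & CompleteNormedModule_isHilbert R H}.

Section Operators.
Context {R : realType} {H : hilbertType R}.
Implicit Types S T : H -> H.

Definition bounded_operator T : Prop :=
  linear T /\ exists M : R, forall x, `|T x| <= M%:C * `|x|.

Definition selfadjoint T : Prop := forall x y, inner (T x) y = inner x (T y).

(* In [R[i]], [0 <= z] means that z is real and nonnegative. *)
Definition positive_operator T : Prop := forall x, 0 <= inner (T x) x.

Definition operator_le S T : Prop := positive_operator (T - S).

Definition spectrum T : set R[i] :=
  [set z | ~ exists S, [/\ bounded_operator S,
                          cancel (T - z *: idfun) S & cancel S (T - z *: idfun)]].

Definition poly_operator (p : {poly R}) T : H -> H :=
  \sum_(i < size p) (p`_i)%:C *: iter i T.

(* For self-adjoint T: S is a limit, in operator norm, of operators p(T) with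
   p polynomials converging to f uniformly on the (real) spectrum of T. *)
Definition is_fun_calculus (f : R -> R) T S : Prop :=
  bounded_operator S /\
  forall e : R, 0 < e -> exists p : {poly R},
    (forall r : R, spectrum T r%:C -> `|p.[r] - f r| <= e) /\
    (forall x, `|poly_operator p T x - S x| <= e%:C * `|x|).

(* The operator f(T), for T self-adjoint and f continuous on its spectrum
   (a default value otherwise). *)
Definition fun_calculus (f : R -> R) T : H -> H :=
  xget 0 [set S | is_fun_calculus f T S].

End Operators.

Section FunctionsOnIntervals.
Context {R : realType}.
Implicit Types (J : interval R) (f : R -> R).

(* Limits are taken within J: this gives the one-sided derivative at an
   endpoint of J. *)
Definition diff_quotient f (x y : R) : R := (f y - f x) / (y - x).

Definition differentiable_on J f : Prop :=
  forall x, x \in J ->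
    cvg (diff_quotient f x y @[y --> within [set` J] x^']).

Definition derivative_on J f (x : R) : R :=
  lim (diff_quotient f x y @[y --> within [set` J] x^']).

Definition C1co J f : Prop :=
  differentiable_on J f /\ convex_function ([set` J] : set R^o) f.

Definition increasing_on J f : Prop :=
  forall x, x \in J -> 0 <= derivative_on J f x.

End FunctionsOnIntervals.

(* Main.v *)
Require Import Defs.
From HB Require Import structures.
From mathcomp Require Import all_boot all_order all_algebra.
From mathcomp Require Import sesquilinear.
From mathcomp Require Import complex.
From mathcomp Require Import all_classical all_reals all_analysis.
From mathcomp Require Import ring lra.

Set Implicit Arguments.
Unset Strict Implicit.
Unset Printing Implicit Defensive.

Import Order.TTheory GRing.Theory Num.Theory.
Import numFieldNormedType.Exports.

Local Open Scope classical_set_scope.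
Local Open Scope ring_scope.
Local Open Scope complex_scope.

(** At a unit vector x put s = <Ax,x>, a point of J. Integrating the gradient
    inequality f(t) + f'(t)(s - t) <= f(s) against the spectral measure of B gives
    <f(B)x,x> <= f(s) + <f'(B)Bx,x> - s <f'(B)x,x>, and Jensen's inequality
    f(s) <= <f(A)x,x> concludes. Nonnegativity of gamma follows from A <= B,
    f'(B) >= 0 and the monotonicity of f'. No spectral measure is needed: pointwise
    inequalities on the spectrum pass to operators because a polynomial which is
    nonnegative on the spectrum of T has p(T) >= 0, and the values f(T), f'(T) exist
    by Weierstrass approximation on the convex hull of the spectrum. *)

(** * The real inner product *)

(** Two points shape the development. The spectrum is defined by the failure of bounded inversion,
    so the link between the values of p on the spectrum and p(T) goes through operators that are
    bounded below, a property that a bounded inverse implies and that composition preserves. And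
    [fun_calculus] is a choice among the operators satisfying [is_fun_calculus]: existence has to be
    constructed, which for f' rests on its continuity, a consequence of differentiability and
    convexity. To integrate a pointwise inequality, its two sides are subtracted and the difference,
    as a function on the spectrum, is assembled from sums, scalings and products with the variable,
    each matched by an operator. *)

Lemma Re_realM (R : realType) (a : R) (w : R[i]) :
  complex.Re (a%:C * w) = a * complex.Re w.
Proof. by case: w => u v /=; rewrite mul0r subr0. Qed.

Lemma Re_norm_ge0 (R : realType) (w : R[i]) : 0 <= complex.Re `|w|.
Proof. by rewrite -lecR (RRe_real (normr_real w)) normr_ge0. Qed.

Section RealInnerProduct.
Context {R : realType} {H : hilbertType R}.
Implicit Types (x y z : H) (a c : R).

(** The quadratic form of a self-adjoint operator is real, so taking real parts loses nothing there
    and moves the estimates from [R[i]] to the ordered field [R]. *)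
Definition rip x y : R := complex.Re (inner x y).

Definition rnorm x : R := complex.Re `|x|.

Lemma normE x : `|x| = (rnorm x)%:C.
Proof. by rewrite /rnorm RRe_real ?normr_real. Qed.

Lemma rnorm_ge0 x : 0 <= rnorm x.
Proof. by rewrite -lecR -normE normr_ge0. Qed.

Lemma rnormN x : rnorm (- x) = rnorm x.
Proof. by rewrite /rnorm normrN. Qed.

Lemma rnormB x y : rnorm (x - y) = rnorm (y - x).
Proof. by rewrite /rnorm distrC. Qed.

Lemma rnorm0 : rnorm (0 : H) = 0.
Proof. by rewrite /rnorm normr0. Qed.

Lemma rnormD x y : rnorm (x + y) <= rnorm x + rnorm y.
Proof. by rewrite -lecR rmorphD /= -!normE ler_normD. Qed.

Lemma rnorm_distD z x y : rnorm (x - y) <= rnorm (x - z) + rnorm (z - y).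
Proof. by rewrite -lecR rmorphD /= -!normE ler_distD. Qed.

Lemma rnormZ a x : rnorm (a%:C *: x) = `|a| * rnorm x.
Proof.
apply: complexI; rewrite rmorphM /= -!normE normrZ normc_def /=.
by rewrite expr0n addr0 sqrtr_sqr.
Qed.

Lemma rnorm_eq0 x : rnorm x = 0 -> x = 0.
Proof. by move=> x0; apply/normr0_eq0; rewrite normE x0. Qed.

Lemma inner_rnorm x : inner x x = (rnorm x ^+ 2)%:C.
Proof. by rewrite rmorphXn /= -normE inner_normE. Qed.

Lemma ripxx x : rip x x = rnorm x ^+ 2.
Proof. by rewrite /rip inner_rnorm. Qed.

Lemma innerC x y : inner x y = (inner y x)^*%C.
Proof. by rewrite hermC expr0 mul1r. Qed.

Lemma innerDl x y z : inner (x + y) z = inner x z + inner y z.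
Proof. exact: linearDl. Qed.

Lemma innerDr x y z : inner z (x + y) = inner z x + inner z y.
Proof. exact: linearDr. Qed.

Lemma innerZl (w : R[i]) x z : inner (w *: x) z = w * inner x z.
Proof. exact: linearZl_LR. Qed.

Lemma innerZr (w : R[i]) x z : inner z (w *: x) = w^*%C * inner z x.
Proof. exact: linearZr_LR. Qed.

Lemma ripC x y : rip x y = rip y x.
Proof. by rewrite /rip innerC; case: (inner y x). Qed.

Lemma ripDl x y z : rip (x + y) z = rip x z + rip y z.
Proof. by rewrite /rip innerDl raddfD. Qed.

Lemma ripNl x z : rip (- x) z = - rip x z.
Proof. by rewrite /rip linearNl raddfN. Qed.

Lemma ripBl x y z : rip (x - y) z = rip x z - rip y z.
Proof. by rewrite ripDl ripNl. Qed.

Lemma ripZl a x z : rip (a%:C *: x) z = a * rip x z.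
Proof. by rewrite /rip innerZl Re_realM. Qed.

Lemma ripDr x y z : rip z (x + y) = rip z x + rip z y.
Proof. by rewrite !(ripC z) ripDl. Qed.

Lemma ripBr x y z : rip z (x - y) = rip z x - rip z y.
Proof. by rewrite !(ripC z) ripBl. Qed.

Lemma ripZr a x z : rip z (a%:C *: x) = a * rip z x.
Proof. by rewrite !(ripC z) ripZl. Qed.

Lemma rip0l x : rip 0 x = 0.
Proof. by rewrite /rip linear0l. Qed.

Lemma rnorm_sqB x y : rnorm (x - y) ^+ 2 = rnorm x ^+ 2 - 2 * rip x y + rnorm y ^+ 2.
Proof. by rewrite -!ripxx ripBl !ripBr (ripC y x); ring. Qed.

(** For c > 0, expand the square of the norm of x - c y, bound [rnorm x] by [c * rnorm y] and divide
    by 2c. In this form a norm bound on an operator bounds its quadratic form; Cauchy-Schwarz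
    follows by taking c as the quotient of the norms. *)
Lemma rip_le c x y : 0 <= c -> rnorm x <= c * rnorm y -> rip x y <= c * rnorm y ^+ 2.
Proof.
move=> c0 xy; have [y0|y0] := eqVneq (rnorm y) 0.
  by rewrite (rnorm_eq0 y0) ripC rip0l rnorm0 expr0n mulr0.
have [c00|cn0] := eqVneq c 0.
  have /rnorm_eq0 -> : rnorm x = 0.
    by apply/le_anti; rewrite rnorm_ge0 andbT (le_trans xy)// c00 mul0r.
  by rewrite rip0l c00 mul0r.
have c_gt0 : 0 < c by rewrite lt_def cn0.
have : 0 <= rnorm (x - c%:C *: y) ^+ 2 by rewrite exprn_ge0 ?rnorm_ge0.
rewrite rnorm_sqB ripZr rnormZ (ger0_norm c0) => h.
have h2 : rnorm x ^+ 2 <= (c * rnorm y) ^+ 2 by rewrite lerXn2r ?nnegrE ?mulr_ge0 ?rnorm_ge0.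
rewrite -(ler_pM2l c_gt0).
move: h h2; rewrite !exprMn; lra.
Qed.

Lemma rip_abs_le c x y : 0 <= c -> rnorm x <= c * rnorm y ->
  `|rip x y| <= c * rnorm y ^+ 2.
Proof.
move=> c0 xy; rewrite ler_norml rip_le// andbT lerNl -ripNl.
by rewrite rip_le// rnormN.
Qed.

Lemma cauchy_limit (u : nat -> H) (e : nat -> R) :
  (forall n m, (n <= m)%N -> rnorm (u m - u n) <= e n) ->
  (forall d, 0 < d -> exists N, forall n, (N <= n)%N -> e n <= d) ->
  exists l, forall n, rnorm (l - u n) <= e n.
Proof.
move=> ue e0.
have /cauchy_cvgP/cvg_ex[l ul] : cauchy (u @ \oo).
  (* Radii are elements of [R[i]]; a positive one is real, so its real part carries it. *)
  apply/cauchy_ballP => d d0; have d'0 : 0 < complex.Re d by move: d0; rewrite ltcE => /andP[].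
  have dE : d = (complex.Re d)%:C by rewrite RRe_real // gtr0_real.
  have d3 : 0 < complex.Re d / 3 by rewrite divr_gt0.
  have [N hN] := e0 _ d3; near_simpl.
  exists ([set n | (N <= n)%N], [set n | (N <= n)%N]); first by split; exists N.
  move=> [n m] [/= Nn Nm]; rewrite -ball_normE /ball_ /=.
  rewrite normE dE ltcR (le_lt_trans (rnorm_distD (u N) _ _))//.
  rewrite (rnormB _ (u m)).
  have := ue _ _ Nn; have := ue _ _ Nm; have := hN N (leqnn _); lra.
exists l => n; apply/ler_addgt0Pr => d d0.
have dC : 0 < d%:C by rewrite ltcR.
have [N _ hN] := (cvgrPdist_lt _ _).1 ul _ dC.
have := hN (maxn N n) (leq_maxl _ _); rewrite /= normE ltcR => h1.
have h2 := ue n (maxn N n) (leq_maxr _ _).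
have := rnorm_distD (u (maxn N n)) l (u n); lra.
Unshelve. all: by end_near.
Qed.

End RealInnerProduct.

(** * Coercive operators are invertible *)

Section Operators.
Context {R : realType} {H : hilbertType R}.
Implicit Types (x y z : H) (a c : R) (S T P : H -> H).

Lemma rip_le_rnormM x y : rip x y <= rnorm x * rnorm y.
Proof.
have [y0|y0] := eqVneq (rnorm y) 0.
  by rewrite (rnorm_eq0 y0) ripC rip0l rnorm0 mulr0.
have := @rip_le _ _ (rnorm x / rnorm y) x y.
rewrite divfK// expr2 mulrA divfK//; apply => //.
by rewrite divr_ge0 ?rnorm_ge0.
Qed.

Lemma linear_opB T : linear T -> forall x y, T (x - y) = T x - T y.
Proof.
by move=> lT x y; rewrite -[x - y]addrC -scaleN1r lT scaleN1r addrC.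
Qed.

Lemma linear_op0 T : linear T -> T 0 = 0.
Proof. by move=> lT; have := linear_opB lT 0 0; rewrite !subrr. Qed.

Lemma linear_opD T : linear T -> forall x y, T (x + y) = T x + T y.
Proof. by move=> lT x y; have := lT 1 x y; rewrite !scale1r. Qed.

Lemma linear_opZ T : linear T -> forall (w : R[i]) x, T (w *: x) = w *: T x.
Proof. by move=> lT w x; rewrite -[w *: x]addr0 lT linear_op0// addr0. Qed.

Lemma linear_opN T : linear T -> forall x, T (- x) = - T x.
Proof. by move=> lT x; rewrite -scaleN1r linear_opZ// scaleN1r. Qed.

Lemma bounded_rnorm T : bounded_operator T ->
  exists2 c, 0 < c & forall x, rnorm (T x) <= c * rnorm x.
Proof.
move=> [_ [M hM]]; exists (`|M| + 1); first by rewrite ltr_wpDl ?normr_ge0.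
move=> x; have := hM x; rewrite !normE -rmorphM lecR => /le_trans; apply.
by rewrite ler_wpM2r ?rnorm_ge0// (le_trans (ler_norm M))// lerDl.
Qed.

Lemma bounded_operatorI c T : linear T ->
  (forall x, rnorm (T x) <= c * rnorm x) -> bounded_operator T.
Proof.
move=> lT h; split=> //; exists c => x.
by rewrite !normE -rmorphM lecR.
Qed.

(** Banach's fixed point theorem for the affine map F, iterated from 0. *)
Lemma linear_contraction_solve (K : H -> H) (k : R) : linear K -> 0 <= k < 1 ->
  (forall x, rnorm (K x) <= k * rnorm x) -> forall y, exists x, x = K x + y.
Proof.
move=> lK /andP[k0 k1] hK y.
pose F x := K x + y; pose u n := iter n F 0.
(* D is the solution of D = k D + |y|, hence a bound for all iterates. *)
pose D := rnorm y / (1 - k).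
have D0 : 0 <= D by rewrite divr_ge0 ?rnorm_ge0// subr_ge0 ltW.
have FB v w : rnorm (F v - F w) <= k * rnorm (v - w).
  by rewrite /F opprD addrACA subrr addr0 -linear_opB.
have uD n : rnorm (u n) <= D.
  elim: n => [|n IH]; first by rewrite /u/= rnorm0.
  rewrite /u iterS -/(u n) /F (le_trans (rnormD _ _))//.
  have -> : D = k * D + rnorm y by rewrite /D; field; rewrite subr_eq0 gt_eqF.
  by rewrite lerD2r (le_trans (hK _))// ler_wpM2l.
have ue n m : (n <= m)%N -> rnorm (u m - u n) <= D * k ^+ n.
  move=> nm; rewrite -(subnK nm); move: (m - n)%N => j {m nm}.
  elim: n => [|n IH]; first by rewrite addn0 expr0 mulr1 subr0.
  rewrite addnS /u !iterS -/(u n) -/(u (j + n)%N) (le_trans (FB _ _))//.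
  by rewrite exprS mulrCA ler_wpM2l.
have e0 d : 0 < d -> exists N, forall n, (N <= n)%N -> D * k ^+ n <= d.
  move=> d0; have kn : `|k| < 1 by rewrite ger0_norm.
  have dD : 0 < d / (D + 1) by rewrite divr_gt0// ltr_wpDl.
  have [N _ hN] := (cvgrPdist_lt _ _).1 (cvg_expr kn) _ dD.
  exists N => n /hN; rewrite sub0r normrN ger0_norm ?exprn_ge0// => h.
  rewrite -(@ler_pM2l _ (D + 1)^-1) ?invr_gt0 ?ltr_wpDl//.
  rewrite (mulrC _ d); apply: le_trans (ltW h).
  by rewrite mulrA ler_piMl ?exprn_ge0// mulrC ler_pdivrMr ?ltr_wpDl// mul1r lerDl.
have [l hl] := cauchy_limit ue e0.
exists l; apply/eqP; rewrite -subr_eq0; apply/eqP/rnorm_eq0/le_anti.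
rewrite rnorm_ge0 andbT; apply/ler_addgt0Pr => d d0; rewrite add0r.
have d2 : 0 < d / 2 by rewrite divr_gt0.
have [N hN] := e0 _ d2.
have h1 := hl N.+1; have h2 := FB (u N) l; have h3 := hl N.
have h4 := hN _ (leqnn _); have h5 := hN _ (leqnSn _).
have := rnorm_distD (u N.+1) l (K l + y); rewrite {2}/u iterS -/(u N) -/(F l).
have h6 : k * rnorm (u N - l) <= rnorm (u N - l).
  by rewrite ler_piMl ?rnorm_ge0// ltW.
by move: h2 h6; rewrite (rnormB (u N) l); lra.
Qed.

(* Lax-Milgram: for small t the map x - t P x is a strict contraction. *)
Lemma coercive_inverse P (d : R) : bounded_operator P -> 0 < d ->
  (forall x, d * rnorm x ^+ 2 <= rip (P x) x) ->
  exists S, [/\ bounded_operator S, cancel P S & cancel S P].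
Proof.
move=> bP d0 dP; have [c0 c0_gt0 hc0] := bounded_rnorm bP.
have lP := bP.1.
(* Adding d to the norm bound ensures d <= c, so that q below is nonnegative. *)
pose c := c0 + d; have c_gt0 : 0 < c by rewrite addr_gt0.
have hc x : rnorm (P x) <= c * rnorm x.
  by rewrite (le_trans (hc0 x))// ler_wpM2r ?rnorm_ge0// lerDl ltW.
have dc : d <= c by rewrite lerDr ltW.
(* This t minimizes 1 - 2 t d + t^2 c^2, which bounds |x - t P x|^2 / |x|^2; the minimum is q. *)
pose t := d / c ^+ 2; have t0 : 0 < t by rewrite divr_gt0 ?exprn_gt0.
pose q := 1 - (d / c) ^+ 2.
have dc1 : 0 < d / c <= 1 by rewrite divr_gt0//= ler_pdivrMr// mul1r.
have q0 : 0 <= q.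
  by case/andP: dc1 => h1 h2; rewrite /q subr_ge0 exprn_ile1// ltW.
have q1 : q < 1 by rewrite /q ltrBlDr ltrDl exprn_gt0//; case/andP: dc1.
pose K x := x - t%:C *: P x.
have lK : linear K.
  move=> w x y; rewrite /K lP scalerBr scalerDr !scalerA (mulrC w).
  by rewrite opprD addrACA.
have hK x : rnorm (K x) <= Num.sqrt q * rnorm x.
  rewrite -[leRHS]ger0_norm ?mulr_ge0 ?sqrtr_ge0 ?rnorm_ge0//.
  rewrite -[leLHS]ger0_norm ?rnorm_ge0// -ler_sqr ?nnegrE// !real_normK ?num_real//.
  rewrite exprMn sqr_sqrtr//.
  rewrite /K rnorm_sqB ripZr rnormZ (ger0_norm (ltW t0)) ripC exprMn.
  have h1 : rnorm (P x) ^+ 2 <= c ^+ 2 * rnorm x ^+ 2.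
    by rewrite -exprMn lerXn2r ?nnegrE ?mulr_ge0 ?rnorm_ge0// ltW.
  have h2 : t ^+ 2 * rnorm (P x) ^+ 2 <= t ^+ 2 * (c ^+ 2 * rnorm x ^+ 2).
    by rewrite ler_wpM2l// exprn_ge0// ltW.
  have h3 : t * (d * rnorm x ^+ 2) <= t * rip (P x) x by rewrite ler_wpM2l// ltW.
  have h4 : t * d = (d / c) ^+ 2 by rewrite /t; field; rewrite gt_eqF.
  have h5 : t ^+ 2 * c ^+ 2 = (d / c) ^+ 2 by rewrite /t; field; rewrite gt_eqF.
  move: h2 h3; rewrite (mulrA _ (c ^+ 2)) h5 (mulrA t) h4 /q; lra.
have sq1 : 0 <= Num.sqrt q < 1.
  by rewrite sqrtr_ge0/= -sqrtr1 ltr_sqrt.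
(* A fixed point x = K x + t y satisfies t P x = t y. *)
have surj y : exists x, P x = y.
  have [x xE] := linear_contraction_solve lK sq1 hK (t%:C *: y).
  exists x; have tn : t%:C != 0 by rewrite (inj_eq (@complexI _)) gt_eqF.
  apply: (scalerI tn); apply/eqP; rewrite -subr_eq0; move/eqP: xE.
  by rewrite /K -addrA -subr_eq0 opprD addrA subrr add0r opprD opprK.
have below x : d * rnorm x <= rnorm (P x).
  have [x0|x0] := eqVneq (rnorm x) 0; first by rewrite x0 mulr0 rnorm_ge0.
  have xp : 0 < rnorm x by rewrite lt_def x0 rnorm_ge0.
  rewrite -(ler_pM2r xp) -mulrA -expr2 (le_trans (dP x))//.
  exact: rip_le_rnormM.
have inj : injective P.
  move=> x y xy; apply/eqP; rewrite -subr_eq0; apply/eqP/rnorm_eq0/le_anti.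
  have := below (x - y); rewrite linear_opB// xy subrr rnorm0.
  by rewrite pmulr_rle0// => ->; rewrite rnorm_ge0.
have [S hS] := choice surj.
exists S; split=> //; last by move=> x; apply: inj; rewrite hS.
apply: (@bounded_operatorI d^-1).
  by move=> w x y; apply: inj; rewrite lP !hS.
by move=> x; rewrite ler_pdivlMl// (le_trans (below _))// hS.
Qed.

End Operators.

(** * Polynomials in an operator *)

Section PolynomialsOfOperators.
Context {R : realType} {H : hilbertType R}.
Implicit Types (x y z : H) (a c : R) (S T P : H -> H).

Lemma rnormZC (w : R[i]) x : rnorm (w *: x) = complex.Re `|w| * rnorm x.
Proof.
by rewrite -Re_realM (RRe_real (normr_real w)) -normrZ.
Qed.

Lemma bounded_operatorD S T : bounded_operator S -> bounded_operator T ->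
  bounded_operator (S + T).
Proof.
move=> bS bT; have [c _ hc] := bounded_rnorm bS; have [d _ hd] := bounded_rnorm bT.
apply: (@bounded_operatorI _ _ (c + d)) => [w x y|x]; rewrite !addrfctE.
  by rewrite bS.1 bT.1 scalerDr addrACA.
by rewrite (le_trans (rnormD _ _))// mulrDl lerD.
Qed.

Lemma bounded_operatorZ (w : R[i]) T : bounded_operator T -> bounded_operator (w *: T).
Proof.
move=> bT; have [c _ hc] := bounded_rnorm bT.
apply: (@bounded_operatorI _ _ (complex.Re `|w| * c)) => [v x y|x].
  by rewrite !scalrfctE bT.1 scalerDr !scalerA mulrC.
by rewrite !scalrfctE rnormZC -mulrA ler_wpM2l// Re_norm_ge0.
Qed.

Lemma bounded_operator_comp S T : bounded_operator S -> bounded_operator T ->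
  bounded_operator (S \o T).
Proof.
move=> bS bT; have [c c0 hc] := bounded_rnorm bS; have [d _ hd] := bounded_rnorm bT.
apply: (@bounded_operatorI _ _ (c * d)) => [w x y|x] /=; first by rewrite bT.1 bS.1.
by rewrite (le_trans (hc _))// -mulrA ler_wpM2l// ltW.
Qed.

Lemma bounded_operator0 : bounded_operator (0 : H -> H).
Proof.
apply: (@bounded_operatorI _ _ 0) => [w x y|x]; first by rewrite scaler0 addr0.
by rewrite rnorm0 mul0r.
Qed.

Lemma bounded_operator_id : bounded_operator (idfun : H -> H).
Proof. by apply: (@bounded_operatorI _ _ 1) => [w x y|x] //=; rewrite mul1r. Qed.

Lemma bounded_operator_iter n T : bounded_operator T -> bounded_operator (iter n T).
Proof.
move=> bT; elim: n => [|n IH]; first exact: bounded_operator_id.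
exact: (bounded_operator_comp bT IH).
Qed.

(** Complex coefficients allow the splitting into linear factors; [poly_operatorE] carries the
    results back to real polynomials. *)
Definition cpoly_operator (p : {poly R[i]}) T : H -> H :=
  \sum_(i < size p) p`_i *: iter i T.

Lemma cpoly_operatorE n (p : {poly R[i]}) T x : (size p <= n)%N ->
  cpoly_operator p T x = \sum_(i < n) p`_i *: iter i T x.
Proof.
move=> pn; rewrite /cpoly_operator fct_sumE.
rewrite (big_ord_widen n (fun i => p`_i *: iter i T x) pn) big_mkcond.
apply: eq_bigr => i _; case: ltnP => // h.
by rewrite nth_default// scale0r.
Qed.

Lemma poly_operatorE (p : {poly R}) T :
  poly_operator p T = cpoly_operator (map_poly (real_complex R) p) T.
Proof.
rewrite /cpoly_operator size_map_poly; apply: eq_bigr => i _.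
by rewrite coef_map.
Qed.

Lemma bounded_cpoly_operator (p : {poly R[i]}) T : bounded_operator T ->
  bounded_operator (cpoly_operator p T).
Proof.
move=> bT; rewrite /cpoly_operator; elim/big_rec: _ => [|i S _ bS].
  exact: bounded_operator0.
by apply: bounded_operatorD => //; apply/bounded_operatorZ/bounded_operator_iter.
Qed.

Lemma cpoly_operatorD (p q : {poly R[i]}) T x :
  cpoly_operator (p + q) T x = cpoly_operator p T x + cpoly_operator q T x.
Proof.
have := size_polyD p q; set n := maxn _ _ => pqn.
rewrite (cpoly_operatorE _ _ pqn) !(@cpoly_operatorE n) ?leq_max ?leqnn ?orbT//.
by rewrite -big_split; apply: eq_bigr => i _; rewrite coefD scalerDl.
Qed.

Lemma cpoly_operatorZ (w : R[i]) (p : {poly R[i]}) T x :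
  cpoly_operator (w *: p) T x = w *: cpoly_operator p T x.
Proof.
rewrite (cpoly_operatorE _ _ (size_scale_leq w p)) (cpoly_operatorE _ _ (leqnn _)).
by rewrite scaler_sumr; apply: eq_bigr => i _; rewrite coefZ scalerA.
Qed.

Lemma cpoly_operatorC (w : R[i]) T x : cpoly_operator w%:P T x = w *: x.
Proof.
by rewrite (cpoly_operatorE _ _ (size_polyC_leq1 w)) big_ord1 coefC.
Qed.

Lemma cpoly_operatorMX (p : {poly R[i]}) T x : cpoly_operator (p * 'X) T x = cpoly_operator p T (T x).
Proof.
have pn : (size (p * 'X)%R <= (size p).+1)%N.
  by rewrite (leq_trans (size_polyMleq _ _))// size_polyX addnC.
rewrite (cpoly_operatorE _ _ pn) (cpoly_operatorE _ _ (leqnn _)) big_ord_recl.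
rewrite coefMX /= scale0r add0r; apply: eq_bigr => i _.
by rewrite coefMX /= -iterSr.
Qed.

Lemma cpoly_operator_comm (p : {poly R[i]}) T x : linear T ->
  cpoly_operator p T (T x) = T (cpoly_operator p T x).
Proof.
move=> lT; elim/poly_ind: p x => [|p w IH] x.
  by rewrite -polyC0 !cpoly_operatorC !scale0r linear_op0.
by rewrite !cpoly_operatorD !cpoly_operatorMX !cpoly_operatorC (linear_opD lT) (linear_opZ lT) IH.
Qed.

Lemma cpoly_operatorM (p q : {poly R[i]}) T x : linear T ->
  cpoly_operator (p * q) T x = cpoly_operator p T (cpoly_operator q T x).
Proof.
move=> lT; elim/poly_ind: p q x => [|p w IH] q x.
  by rewrite mul0r -polyC0 !cpoly_operatorC !scale0r.
rewrite mulrDl -mulrA (mulrC 'X) cpoly_operatorD IH cpoly_operatorMX.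
rewrite mul_polyC cpoly_operatorZ cpoly_operatorD cpoly_operatorMX.
by rewrite cpoly_operatorC cpoly_operator_comm.
Qed.

(** When [T - w *: idfun] fails this, w is in the approximate point spectrum of T. *)
Definition bounded_below T := exists2 c : R, 0 < c & forall x, c * rnorm x <= rnorm (T x).

(** p(T) is a nonzero scalar times a composition of factors T - w over the roots w, and lower bounds
    multiply under composition. Read contrapositively, this is the half of spectral mapping that
    produces a spectral value. *)
Lemma bounded_below_cpoly_operator (p : {poly R[i]}) T : linear T -> p != 0 ->
  (forall w, root p w -> bounded_below (T - w *: idfun)) ->
  bounded_below (cpoly_operator p T).
Proof.
move=> lT p0 hp; have [r pE] := closed_field_poly_normal p.
have hr w : w \in r -> bounded_below (T - w *: idfun).
  by move=> wr; apply: hp; rewrite pE rootZ ?lead_coef_eq0// root_prod_XsubC.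
suff [c c0 hc] : bounded_below (cpoly_operator (\prod_(w <- r) ('X - w%:P)) T).
  have l0 : 0 < complex.Re `|lead_coef p|.
    by rewrite -ltcR (RRe_real (normr_real _)) normr_gt0 lead_coef_eq0.
  exists (complex.Re `|lead_coef p| * c); first by rewrite mulr_gt0.
  by move=> x; rewrite {2}pE cpoly_operatorZ rnormZC -mulrA ler_wpM2l// ltW.
elim: r {pE} hr => [|w r IH] hr.
  by rewrite big_nil; exists 1 => // x; rewrite cpoly_operatorC scale1r mul1r.
have [|c c0 hc] := IH; first by move=> v vr; apply: hr; rewrite inE vr orbT.
have [d d0 hd] := hr w (mem_head _ _).
exists (d * c); first by rewrite mulr_gt0.
move=> x; rewrite big_cons cpoly_operatorM// -mulrA.
apply: (le_trans (ler_wpM2l (ltW d0) (hc x))); apply: (le_trans (hd _)).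
rewrite -polyCN cpoly_operatorD cpoly_operatorC -['X]mul1r cpoly_operatorMX.
by rewrite cpoly_operatorC scale1r scaleNr addrfctE opprfctE scalrfctE.
Qed.

Lemma poly_operatorD (p q : {poly R}) T x :
  poly_operator (p + q) T x = poly_operator p T x + poly_operator q T x.
Proof. by rewrite !poly_operatorE rmorphD cpoly_operatorD. Qed.

Lemma poly_operatorM (p q : {poly R}) T x : linear T ->
  poly_operator (p * q) T x = poly_operator p T (poly_operator q T x).
Proof. by move=> lT; rewrite !poly_operatorE rmorphM cpoly_operatorM. Qed.

Lemma poly_operatorC a T x : poly_operator a%:P T x = a%:C *: x.
Proof. by rewrite !poly_operatorE map_polyC cpoly_operatorC. Qed.

Lemma poly_operatorZ a (p : {poly R}) T x :
  poly_operator (a *: p) T x = a%:C *: poly_operator p T x.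
Proof. by rewrite !poly_operatorE map_polyZ cpoly_operatorZ. Qed.

Lemma poly_operatorMX (p : {poly R}) T x :
  poly_operator (p * 'X) T x = poly_operator p T (T x).
Proof. by rewrite !poly_operatorE rmorphM/= map_polyX cpoly_operatorMX. Qed.

Lemma poly_operatorX T x : poly_operator 'X T x = T x.
Proof. by rewrite -['X]mul1r poly_operatorMX poly_operatorC scale1r. Qed.

Lemma poly_operatorB (p q : {poly R}) T x :
  poly_operator (p - q) T x = poly_operator p T x - poly_operator q T x.
Proof.
by rewrite poly_operatorD -scaleN1r poly_operatorZ rmorphN scaleN1r.
Qed.

Lemma bounded_poly_operator (p : {poly R}) T : bounded_operator T ->
  bounded_operator (poly_operator p T).
Proof. by move=> bT; rewrite poly_operatorE; exact: bounded_cpoly_operator. Qed.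

Lemma selfadjoint_poly_operator (p : {poly R}) T : linear T -> selfadjoint T ->
  selfadjoint (poly_operator p T).
Proof.
move=> lT sT; elim/poly_ind: p => [|p a IH] x y.
  by rewrite -polyC0 !poly_operatorC !scale0r linear0l linear0r.
rewrite !poly_operatorD !poly_operatorMX !poly_operatorC innerDl innerDr.
rewrite IH sT innerZl innerZr conjc_real; congr (inner _ _ + _).
by rewrite poly_operatorE cpoly_operator_comm.
Qed.

End PolynomialsOfOperators.

(** * The spectrum of a self-adjoint operator *)

Section SelfAdjointSpectrum.
Context {R : realType} {H : hilbertType R}.
Implicit Types (x y z : H) (a b c r : R) (S T P : H -> H) (p : {poly R}).

Lemma selfadjoint_rip T x y : selfadjoint T -> rip (T x) y = rip x (T y).
Proof. by move=> sT; rewrite /rip sT. Qed.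

Lemma selfadjoint_innerE T x : selfadjoint T -> inner (T x) x = (rip (T x) x)%:C.
Proof.
move=> sT; have := sT x x; rewrite [RHS]innerC /rip.
case: (inner (T x) x) => u v [] /= h; congr Complex.
have : v *+ 2 = 0 by rewrite mulr2n {1}h addNr.
by move/eqP; rewrite mulrn_eq0 /= => /eqP.
Qed.

Lemma not_bounded_below_spectrum T (w : R[i]) :
  ~ bounded_below (T - w *: idfun) -> spectrum T w.
Proof.
move=> nb [S [bS TS _]]; apply: nb; have [c c0 hc] := bounded_rnorm bS.
by exists c^-1 => [|x]; rewrite ?invr_gt0// ler_pdivrMl// -{1}(TS x).
Qed.

(** With w = a + ib, |(T - w) x|^2 = |(T - a) x|^2 + b^2 |x|^2: the cross term vanishes because the
    quadratic form of T - a is real. *)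
Lemma nonreal_bounded_below T (w : R[i]) : linear T -> selfadjoint T ->
  complex.Im w != 0 -> bounded_below (T - w *: idfun).
Proof.
case: w => a b /= lT sT b0; exists `|b|; first by rewrite normr_gt0.
move=> x; rewrite addrfctE opprfctE scalrfctE /=.
have -> : (a +i* b) *: x = a%:C *: x + (0 +i* b) *: x.
  by rewrite -scalerDl; congr (_ *: _); rewrite /GRing.add/= addr0 add0r.
rewrite opprD addrA; set y := T x - _.
have yx : inner y x = (rip (T x) x - a * rnorm x ^+ 2)%:C.
  rewrite /y -scaleN1r scalerA mulN1r -rmorphN innerDl innerZl selfadjoint_innerE//.
  by rewrite inner_rnorm -rmorphM -rmorphD mulNr.
have h : rip y ((0 +i* b) *: x) = 0.
  by rewrite /rip innerZr yx /= mul0r mulr0 subr0.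
rewrite -ler_sqr ?nnegrE ?mulr_ge0 ?rnorm_ge0// rnorm_sqB h rnormZC.
rewrite normc_def /= expr0n add0r sqrtr_sqr mulr0 subr0 lerDr.
by rewrite exprn_ge0 ?rnorm_ge0.
Qed.

Lemma unit_vector_exists x : x != 0 -> exists u : H, rnorm u = 1.
Proof.
move=> x0; have nx : rnorm x != 0 by apply: contra_neq x0 => /rnorm_eq0.
exists ((rnorm x)^-1%:C *: x).
by rewrite rnormZ ger0_norm ?invr_ge0 ?rnorm_ge0// mulVf.
Qed.

Lemma rip_quadratic_lower S a : linear S ->
  (forall u, rnorm u = 1 -> a <= rip (S u) u) ->
  forall x, a * rnorm x ^+ 2 <= rip (S x) x.
Proof.
move=> lS h x; have [x0|nx] := eqVneq (rnorm x) 0.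
  by rewrite (rnorm_eq0 x0) linear_op0// rip0l rnorm0 expr0n mulr0.
have := h ((rnorm x)^-1%:C *: x).
rewrite rnormZ ger0_norm ?invr_ge0 ?rnorm_ge0// mulVf// => /(_ erefl).
rewrite (linear_opZ lS) ripZl ripZr mulrA -expr2 exprVn.
by rewrite ler_pdivlMl ?exprn_gt0 ?lt_def ?nx ?rnorm_ge0// mulrC.
Qed.

(* Expand [0 <= <P (x - c^-1 P x), x - c^-1 P x>]. *)
Lemma positive_rnorm_sq P c x : linear P -> selfadjoint P -> 0 < c ->
  (forall y, 0 <= rip (P y) y) -> (forall y, rnorm (P y) <= c * rnorm y) ->
  rnorm (P x) ^+ 2 <= c * rip (P x) x.
Proof.
move=> lP sP c0 P0 Pc; have := P0 (x - c^-1%:C *: P x).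
rewrite (linear_opB lP) (linear_opZ lP) !ripBl !ripBr !ripZl !ripZr.
rewrite (selfadjoint_rip (P x) x sP) ripxx => h.
have := rip_le (ltW c0) (Pc (P x)) => h2.
have h3 : c^-1 * (c^-1 * rip (P (P x)) (P x)) <= c^-1 * rnorm (P x) ^+ 2.
  by rewrite ler_pM2l ?invr_gt0// ler_pdivrMl.
by rewrite -ler_pdivrMl//; lra.
Qed.

(* The infimum m of the quadratic form of p(T) is a value of p on the spectrum:
   p(T) - m is positive and not bounded below, hence neither is T - w for some
   root w of p - m, and w is real because T is self-adjoint. *)
Lemma spectrum_attains_poly_inf T p : bounded_operator T -> selfadjoint T ->
  (exists u : H, rnorm u = 1) -> (1 < size p)%N ->
  exists2 r, spectrum T r%:C & forall x, p.[r] * rnorm x ^+ 2 <= rip (poly_operator p T x) x.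
Proof.
move=> bT sT [u0 u01] p1; have lT := bT.1.
have [c c0 hc] := bounded_rnorm (bounded_poly_operator p bT).
pose E := [set rip (poly_operator p T u) u | u in [set u : H | rnorm u = 1]].
have E0 : E !=set0 by exists (rip (poly_operator p T u0) u0), u0.
have lbE : has_lbound E.
  exists (- c) => _ [u /= u1 <-]; have := rip_abs_le (ltW c0) (hc u).
  by rewrite u1 expr1n mulr1 ler_norml => /andP[].
pose m := inf E; have mE u : rnorm u = 1 -> m <= rip (poly_operator p T u) u.
  by move=> u1; apply: (ge_inf lbE); exists u.
have lp : linear (poly_operator p T) := (bounded_poly_operator p bT).1.
have mp := rip_quadratic_lower lp mE.
pose q := p - m%:P; have q0 : q != 0.
  apply: contraTneq p1 => /eqP; rewrite subr_eq0 => /eqP ->.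
  by rewrite -leqNgt size_polyC_leq1.
have bq := bounded_poly_operator q bT; have [d d0 hd] := bounded_rnorm bq.
have qE x : rip (poly_operator q T x) x = rip (poly_operator p T x) x - m * rnorm x ^+ 2.
  by rewrite poly_operatorB poly_operatorC ripBl ripZl ripxx.
have qpos x : 0 <= rip (poly_operator q T x) x by rewrite qE subr_ge0.
(* A lower bound b for q(T) would give <q(T) u, u> >= b^2 / d on unit vectors by
   [positive_rnorm_sq], so m + b^2 / d would be a lower bound of E above its infimum. *)
have nbq : ~ bounded_below (poly_operator q T).
  move=> [b b0 hb]; suff : m + b ^+ 2 / d <= m.
    by rewrite gerDl leNgt divr_gt0// exprn_gt0.
  apply: lb_le_inf => // _ [u /= u1 <-].
  have := positive_rnorm_sq u bq.1 (selfadjoint_poly_operator q lT sT) d0 qpos hd.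
  rewrite qE u1 expr1n mulr1 => h; rewrite addrC -lerBrDr ler_pdivrMr// mulrC.
  apply: le_trans h; rewrite lerXn2r ?nnegrE ?rnorm_ge0 ?(ltW b0)//.
  by have := hb u; rewrite u1 mulr1.
have /existsNP[w /not_implyP[rw nbw]] : ~ (forall w,
    root (map_poly (real_complex R) q) w -> bounded_below (T - w *: idfun)).
  move=> h; apply: nbq; rewrite poly_operatorE.
  by apply: bounded_below_cpoly_operator; rewrite ?map_poly_eq0.
have [w0|w0] := eqVneq (complex.Im w) 0; last first.
  by case: nbw; exact: nonreal_bounded_below.
have wE : w = (complex.Re w)%:C by move: w0; case: (w) => u v /= ->.
exists (complex.Re w); first by rewrite -wE; exact: not_bounded_below_spectrum.
move: rw; rewrite wE /root horner_map /q !hornerE => /eqP/complexI/eqP.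
by rewrite /= subr_eq0 => /eqP ->.
Qed.

(** The ends come from [spectrum_attains_poly_inf] for ['X] and [- 'X]. A real r < a makes T - r
    coercive with constant a - r, hence invertible; for r > b the same holds of r - T. *)
Lemma spectrum_bounds T : bounded_operator T -> selfadjoint T ->
  (exists u : H, rnorm u = 1) ->
  exists a b, [/\ spectrum T a%:C, spectrum T b%:C,
    forall r, spectrum T r%:C -> a <= r <= b &
    forall x, a * rnorm x ^+ 2 <= rip (T x) x <= b * rnorm x ^+ 2].
Proof.
move=> bT sT u1; have lT := bT.1.
have [|a sa ha] := spectrum_attains_poly_inf bT sT u1 (p := 'X).
  by rewrite size_polyX.
have [|b sb hb] := spectrum_attains_poly_inf bT sT u1 (p := - 'X).
  by rewrite size_polyN size_polyX.
have {}ha x : a * rnorm x ^+ 2 <= rip (T x) x.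
  by have := ha x; rewrite hornerX poly_operatorX.
have {}hb x : rip (T x) x <= b * rnorm x ^+ 2.
  have := hb x; rewrite hornerN hornerX -['X]scale1r -scaleNr poly_operatorZ.
  by rewrite poly_operatorX ripZl; lra.
exists a, b; split => // [r sr|x]; last by rewrite ha hb.
have bTr : bounded_operator (T - r%:C *: idfun).
  by rewrite -scaleNr; apply: bounded_operatorD => //; exact/bounded_operatorZ/bounded_operator_id.
apply/andP; split; rewrite leNgt; apply/negP => h; apply: sr.
  apply: (coercive_inverse bTr (d := a - r)); first by rewrite subr_gt0.
  move=> x; rewrite addrfctE opprfctE scalrfctE /= ripBl ripZl ripxx.
  by have := ha x; lra.
have [|||S [bS S1 S2]] := @coercive_inverse _ _ (- (T - r%:C *: idfun)) (r - b).
- by rewrite -scaleN1r; exact: bounded_operatorZ.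
- by rewrite subr_gt0.
- move=> x; rewrite -[(- (T - r%:C *: idfun)) x]/(- (T x - r%:C *: x)) ripNl ripBl ripZl ripxx.
  by have := hb x; lra.
exists (- S); split.
- by rewrite -scaleN1r; exact: bounded_operatorZ.
- by move=> x; rewrite -[RHS]S1 -[RHS]/(S (- ((T - r%:C *: idfun) x))) (linear_opN bS.1).
- by move=> x; rewrite -[RHS]S2 -[(- S) x]/(- S x) (linear_opN bTr.1).
Qed.

Lemma poly_operator_positive T p : bounded_operator T -> selfadjoint T ->
  (forall r, spectrum T r%:C -> 0 <= p.[r]) ->
  forall x, 0 <= rip (poly_operator p T x) x.
Proof.
move=> bT sT hp x; have [->|x0] := eqVneq x 0.
  by rewrite linear_op0 ?rip0l//; exact: (bounded_poly_operator p bT).1.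
have u1 := unit_vector_exists x0; have [p1|p1] := ltnP 1 (size p).
  have [r sr /(_ x)] := spectrum_attains_poly_inf bT sT u1 p1.
  by apply: le_trans; rewrite mulr_ge0 ?exprn_ge0 ?rnorm_ge0// hp.
(* A constant p is nonnegative because the spectrum contains at least one real point. *)
have [a [_ [sa _ _ _]]] := spectrum_bounds bT sT u1; have := hp _ sa.
rewrite (size1_polyC p1) hornerC => h.
by rewrite poly_operatorC ripZl ripxx mulr_ge0 ?exprn_ge0 ?rnorm_ge0.
Qed.

(** Positivity applied to c^2 - p^2: since p(T) is self-adjoint, the quadratic form of c^2 - p(T)^2
    at x is c^2 |x|^2 - |p(T) x|^2. *)
Lemma poly_operator_rnorm_le T p c : bounded_operator T -> selfadjoint T -> 0 <= c ->
  (forall r, spectrum T r%:C -> `|p.[r]| <= c) ->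
  forall x, rnorm (poly_operator p T x) <= c * rnorm x.
Proof.
move=> bT sT c0 hp x; have lT := bT.1.
have := @poly_operator_positive T ((c ^+ 2)%:P - p * p) bT sT _ x.
rewrite poly_operatorB poly_operatorC poly_operatorM// ripBl ripZl.
rewrite selfadjoint_rip; last exact: selfadjoint_poly_operator.
rewrite !ripxx subr_ge0 -exprMn ler_sqr ?nnegrE ?mulr_ge0 ?rnorm_ge0//; apply.
move=> r sr; rewrite !hornerE -expr2 subr_ge0 -[p.[r] ^+ 2]real_normK ?num_real//.
by rewrite lerXn2r ?nnegrE// hp.
Qed.

End SelfAdjointSpectrum.

(** * Weierstrass approximation *)

Section PolynomialApproximation.
Context {R : realType}.
Implicit Types (a b c e v x y : R) (g : R -> R).

(* Bernstein polynomial of the values [h 0, ..., h n] on [0, 1], as the mean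
   value of [h] after [n] Bernoulli trials, conditioned on the first trial. *)
Fixpoint bernstein n (h : nat -> R) : {poly R} :=
  if n is n'.+1 then 'X * bernstein n' (h \o S) + (1 - 'X) * bernstein n' h
  else (h 0%N)%:P.

(* [n x (1 - x) + (n x - c)^2] is the second moment about [c] of the
   binomial distribution. *)
Lemma bernstein_dist n (h : nat -> R) x v c e M : 0 <= x <= 1 ->
  (forall k, (k <= n)%N -> `|h k - v| <= e + M * (k%:R - c) ^+ 2) ->
  `|(bernstein n h).[x] - v| <= e + M * (n%:R * x * (1 - x) + (n%:R * x - c) ^+ 2).
Proof.
move=> /andP[x0 x1]; elim: n h c => [|n IH] h c hk /=.
  by have := hk 0%N isT; rewrite mulr0n hornerC !mul0r !add0r.
(* After a success the other n trials are counted from 1, which shifts the centre to c - 1. *)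
have hS k : (k <= n)%N -> `|(h \o S) k - v| <= e + M * (k%:R - (c - 1)) ^+ 2.
  by move=> kn; have := hk k.+1 kn; rewrite -natr1 opprB addrA.
have h0 k : (k <= n)%N -> `|h k - v| <= e + M * (k%:R - c) ^+ 2.
  by move=> kn; apply: hk; exact: leqW.
rewrite !hornerE.
set B1 := (bernstein n (h \o S)).[x]; set B0 := (bernstein n h).[x].
have -> : x * B1 + (1 - x) * B0 - v = x * (B1 - v) + (1 - x) * (B0 - v) by ring.
have x1' : 0 <= 1 - x by rewrite subr_ge0.
rewrite (le_trans (ler_normD _ _))// !normrM (ger0_norm x0) (ger0_norm x1').
have i1 : x * `|B1 - v| <= x * _ := ler_wpM2l x0 (IH _ _ hS).
have i0 : (1 - x) * `|B0 - v| <= (1 - x) * _ := ler_wpM2l x1' (IH _ _ h0).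
(* The second moments of n trials about c - 1 and c, averaged with weights x and 1 - x, give that of
   n + 1 trials about c. *)
apply: (le_trans (lerD i1 i0)); rewrite -natr1 le_eqVlt; apply/orP; left.
by apply/eqP; ring.
Qed.

(* For bounded [g] this is uniform continuity; the quadratic term is what the
   second moment in [bernstein_dist] controls. *)
Definition quadratic_modulus a b g : Prop := forall e, 0 < e ->
  exists2 M, 0 <= M & forall x y, a <= x <= b -> a <= y <= b ->
    `|g x - g y| <= e + M * (x - y) ^+ 2.

Lemma weierstrass_approximation a b g : a <= b -> quadratic_modulus a b g ->
  forall e, 0 < e -> exists p : {poly R}, forall x, a <= x <= b -> `|p.[x] - g x| <= e.
Proof.
rewrite le_eqVlt => /orP[/eqP <-{b} _ e e0|ab gM e e0].
  exists (g a)%:P => x ax; have -> : x = a by apply/le_anti; rewrite andbC.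
  by rewrite hornerC subrr normr0 ltW.
have [|M M0 hM] := gM (e / 2); first by rewrite divr_gt0.
pose l := b - a; have l0 : 0 < l by rewrite subr_gt0.
pose L := M * l ^+ 2; have L0 : 0 <= L by rewrite mulr_ge0// exprn_ge0// ltW.
(* n >= 2 L / e makes the variance contribution L s (1 - s) / n at most e / 2. *)
pose n := (Num.bound (2 * L / e)).+1.
have n0 : 0 < n%:R :> R by rewrite ltr0n.
have nL : L / n%:R <= e / 2.
  rewrite ler_pdivrMr// -ler_pdivrMl ?divr_gt0// invf_div.
  have : 2 * L / e <= n%:R.
    have Le0 : 0 <= 2 * L / e by rewrite divr_ge0 ?mulr_ge0// ltW.
    by apply: le_trans (ltW (archi_boundP Le0)) _; rewrite ler_nat.
  by apply: le_trans; rewrite mulrAC.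
pose h k := g (a + l * (k%:R / n%:R)).
exists (bernstein n h \Po (l^-1 *: ('X - a%:P))) => x /andP[ax xb].
rewrite horner_comp hornerZ hornerXsubC; set s := l^-1 * (x - a).
have xE : x = a + l * s by rewrite /s mulVKf ?gt_eqF// subrKC.
have s0 : 0 <= s by rewrite mulr_ge0 ?subr_ge0// invr_ge0 ltW.
have s1 : s <= 1 by rewrite ler_pdivrMl// mulr1 lerD2r.
have s01 : 0 <= s <= 1 by rewrite s0.
have hk k : (k <= n)%N -> `|h k - g x| <= e / 2 + L / n%:R ^+ 2 * (k%:R - n%:R * s) ^+ 2.
  move=> kn; have k01 : 0 <= (k%:R / n%:R : R) <= 1.
    by rewrite divr_ge0//= ler_pdivrMr// mul1r ler_nat.
  have kab : a <= a + l * (k%:R / n%:R) <= b.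
    case/andP: k01 => k0 k1; rewrite lerDl mulr_ge0 ?(ltW l0)//= -lerBrDl.
    by rewrite -[leRHS]mulr1 ler_pM2l.
  have := hM _ x kab; rewrite ax xb => /(_ isT) /le_trans; apply.
  rewrite lerD2l {1}xE le_eqVlt; apply/orP; left; apply/eqP.
  by rewrite /L; field; rewrite gt_eqF.
(* The centre n s is the binomial mean, so the squared bias is zero and only the variance is
   left. *)
have := bernstein_dist s01 hk; rewrite subrr expr0n addr0 => /le_trans; apply.
have -> : L / n%:R ^+ 2 * (n%:R * s * (1 - s)) = L / n%:R * (s * (1 - s)).
  by field; rewrite gt_eqF.
have : L / n%:R * (s * (1 - s)) <= L / n%:R * 1.
  rewrite ler_wpM2l ?divr_ge0// ?(ltW n0)//.
  by rewrite mulr_ile1 ?subr_ge0// lerBlDr lerDl.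
by lra.
Qed.

(** Use t <= 1 + t^2 at t = M |x - y| / e, multiplied by e. *)
Lemma lipschitz_quadratic_modulus a b g M :
  (forall x y, a <= x <= b -> a <= y <= b -> `|g x - g y| <= M * `|x - y|) ->
  quadratic_modulus a b g.
Proof.
move=> h e e0; exists (M ^+ 2 / e); first by rewrite divr_ge0 ?sqr_ge0// ltW.
move=> x y hx hy; rewrite (le_trans (h x y hx hy))//.
rewrite -[(x - y) ^+ 2]real_normK ?num_real//; set d := `|x - y|.
have -> : M * d = (M * d / e) * e by rewrite divfK ?gt_eqF.
have -> : e + M ^+ 2 / e * d ^+ 2 = (1 + (M * d / e) ^+ 2) * e by field; rewrite gt_eqF.
rewrite ler_pM2r//; have := sqr_ge0 (M * d / e - 1); have := sqr_ge0 (M * d / e + 1).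
by rewrite sqrrB sqrrD; lra.
Qed.

(** Around each point a large M works: close pairs are handled by continuity, distant ones by the
    bound 2G on |g x - g y|. Compactness of the segment makes M uniform in x. *)
Lemma continuous_quadratic_modulus a b g (G : R) :
  (forall x, a <= x <= b -> `|g x| <= G) ->
  (forall x e, a <= x <= b -> 0 < e -> exists2 d, 0 < d & forall y, a <= y <= b ->
     `|y - x| < d -> `|g y - g x| <= e) ->
  quadratic_modulus a b g.
Proof.
move=> gG gc e e0.
pose P (M x : R) := forall y, a <= y <= b -> a <= x <= b -> `|g x - g y| <= e + M * (x - y) ^+ 2.
have : \forall M \near +oo, `[a, b]%classic `<=` P M.
  apply: (proj1 (compact_near_coveringP _) (@segment_compact _ a b)) => x /=.
  rewrite in_itv /= => xab.
  have [|d d0 hd] := gc x (e / 2) xab; first by rewrite divr_gt0.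
  have d2 : 0 < d / 2 by rewrite divr_gt0.
  (* Chosen so that the quadratic term reaches 2G as soon as the points are d / 2 apart. *)
  pose M0 := 2 * G / (d / 2) ^+ 2.
  have G0 : 0 <= G by apply: le_trans (gG _ xab); rewrite normr_ge0.
  have M00 : 0 <= M0 by apply: divr_ge0; [exact: mulr_ge0 | exact: sqr_ge0].
  exists (ball x (d / 2), [set M | M0 < M]).
    by split => /=; [exact: nbhsx_ballx | apply: nbhs_pinfty_gt; exact: num_real].
  move=> [x' M] [/= bx M0M] y yab x'ab.
  move: bx; rewrite /ball /= => bx.
  have Mge0 : 0 <= M by exact: le_trans (ltW M0M).
  have [xy|xy] := ltP `|x' - y| (d / 2).
    have yx : `|y - x| < d.
      rewrite (le_lt_trans (ler_distD x' _ _))// [ltRHS]splitr ltrD//; first by rewrite distrC.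
      by rewrite distrC.
    have x'x : `|x' - x| < d.
      by rewrite distrC (lt_le_trans bx)// ler_pdivrMr// ler_pMr// ler1n.
    have := hd _ yab yx; have := hd _ x'ab x'x; have := ler_distD (g x) (g x') (g y).
    rewrite (distrC (g x) (g y)).
    have : 0 <= M * (x' - y) ^+ 2 by apply: mulr_ge0 => //; exact: sqr_ge0.
    by lra.
  have h1 : M0 * (d / 2) ^+ 2 <= M * (x' - y) ^+ 2.
    apply: ler_pM; rewrite ?sqr_ge0 ?(ltW M0M)//.
    by rewrite -[(x' - y) ^+ 2]real_normK ?num_real// lerXn2r ?nnegrE// ltW.
  have h2 : M0 * (d / 2) ^+ 2 = 2 * G by rewrite /M0 divfK// expf_neq0// gt_eqF.
  have := ler_normB (g x') (g y); have := gG _ yab; have := gG _ x'ab; lra.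
move=> hM.
have : \forall M \near +oo, 0 <= M /\ `[a, b]%classic `<=` P M.
  by near=> M; split; near: M => //; apply: nbhs_pinfty_ge; exact: num_real.
move=> [M0 [_ /(_ (M0 + 1))]]; rewrite ltrDl ltr01 => /(_ isT)[M0' hP].
by exists (M0 + 1) => // x y xab yab; apply: (hP x) => //=; rewrite in_itv.
Unshelve. all: by end_near.
Qed.

End PolynomialApproximation.

(** * Functional calculus *)

Lemma le0_mul_epsilon (R : realType) (C r : R) : 0 <= C ->
  (forall e, 0 < e -> r <= C * e) -> r <= 0.
Proof.
move=> C0 h; apply/ler_addgt0Pr => d d0; rewrite add0r.
have C1 : 0 < C + 1 by rewrite ltr_wpDl.
apply: (le_trans (h (d / (C + 1)) _)); first by rewrite divr_gt0.
by rewrite mulrA ler_pdivrMr// mulrC ler_pM2l// lerDl.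
Qed.

Lemma invS_le_epsilon (R : realType) (e : R) : 0 < e ->
  exists N, forall n, (N <= n)%N -> n.+1%:R^-1 <= e.
Proof.
move=> e0; exists (Num.bound e^-1) => n Nn; rewrite -[leRHS]invrK lef_pV2 ?posrE ?invr_gt0//.
have /archi_boundP/ltW/le_trans : 0 <= e^-1 by rewrite invr_ge0 ltW.
by apply; rewrite ler_nat leqW.
Qed.

Section FunctionalCalculus.
Context {R : realType} {H : hilbertType R}.
Implicit Types (x y z : H) (a b c e r : R) (f g : R -> R) (S T : H -> H) (p : {poly R}).

Lemma is_fun_calculusP f T S : is_fun_calculus f T S <-> bounded_operator S /\
  forall e, 0 < e -> exists2 p, forall r, spectrum T r%:C -> `|p.[r] - f r| <= e &
    forall x, rnorm (poly_operator p T x - S x) <= e * rnorm x.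
Proof.
split=> -[bS h]; split=> // e /h.
  case=> p [p1 p2]; exists p => // x.
  by rewrite -lecR rmorphM /= -!normE.
by case=> p p1 p2; exists p; split=> // x; rewrite !normE -rmorphM lecR.
Qed.

(** Replacing x by i x turns the identity of real parts into that of imaginary parts. *)
Lemma rip_selfadjoint S : linear S -> (forall x y, rip (S x) y = rip x (S y)) ->
  selfadjoint S.
Proof.
move=> lS h x y; have h1 := h x y; have := h ('i *: x) y.
rewrite linear_opZ// /rip !innerZl; move: h1; rewrite /rip.
case: (inner (S x) y) => u v; case: (inner x (S y)) => u' v' /= ->.
by rewrite !mul0r !mul1r !sub0r => /oppr_inj ->.
Qed.

(** Polynomials within 1 / (n + 1) of g on [a, b] differ on the spectrum by at most 2 / (n + 1) from
    the n-th on, so by [poly_operator_rnorm_le] their operators are Cauchy in norm; S is the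
    pointwise limit, with the same rate. *)
Lemma fun_calculusP T g a b : bounded_operator T -> selfadjoint T -> a <= b ->
  (forall r, spectrum T r%:C -> a <= r <= b) -> quadratic_modulus a b g ->
  is_fun_calculus g T (fun_calculus g T).
Proof.
move=> bT sT ab Tab gM; apply: xgetPex.
have e_gt0 n : 0 < n.+1%:R^-1 :> R by rewrite invr_gt0.
have /choice[p hp] n := weierstrass_approximation ab gM (e_gt0 n).
have pp n m x : (n <= m)%N -> rnorm (poly_operator (p m) T x - poly_operator (p n) T x)
    <= 2 * rnorm x * n.+1%:R^-1.
  move=> nm; rewrite -poly_operatorB mulrAC; apply: poly_operator_rnorm_le => //.
  move=> r /Tab rab; rewrite hornerD hornerN.
  have h1 := hp n _ rab; have h2 := hp m _ rab; have h3 : m.+1%:R^-1 <= n.+1%:R^-1 :> R.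
    by rewrite lef_pV2 ?posrE// ler_nat.
  have := ler_distD (g r) (p m).[r] (p n).[r].
  rewrite (distrC (g r)); move: h1 h2 h3.
  by move: (n.+1%:R^-1) (m.+1%:R^-1) => u v; lra.
have /choice[S hS] x : exists l, forall n,
    rnorm (l - poly_operator (p n) T x) <= 2 * rnorm x * n.+1%:R^-1.
  apply: cauchy_limit => [n m nm|d d0]; first exact: pp.
  have dx : 0 < d / (2 * rnorm x + 1) by rewrite divr_gt0// ltr_wpDl// mulr_ge0 ?rnorm_ge0.
  have [N hN] := invS_le_epsilon dx; exists N => n /hN h.
  have h0 : 0 <= 2 * rnorm x by rewrite mulr_ge0 ?rnorm_ge0.
  apply: (le_trans (ler_wpM2l h0 h)); rewrite mulrA ler_pdivrMr ?ltr_wpDl//.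
  by rewrite mulrC ler_pM2l// lerDl.
have lS : linear S.
  move=> w x y; apply/eqP; rewrite -subr_eq0; apply/eqP/rnorm_eq0/le_anti.
  rewrite rnorm_ge0 andbT.
  apply: (@le0_mul_epsilon _ (2 * rnorm (w *: x + y) + complex.Re `|w| * (2 * rnorm x) + 2 * rnorm y)).
    by rewrite !addr_ge0 ?mulr_ge0 ?Re_norm_ge0 ?rnorm_ge0.
  move=> e /invS_le_epsilon[n /(_ n (leqnn n)) ne].
  have w0 := Re_norm_ge0 w.
  rewrite (le_trans _ (ler_wpM2l _ ne))//; last first.
    by rewrite !addr_ge0 ?mulr_ge0 ?rnorm_ge0.
  set D := poly_operator (p n) T.
  have lD : linear D := (bounded_poly_operator (p n) bT).1.
  (* Since D is linear, the defect of linearity of S consists of three differences S - D, each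
     controlled by the rate. *)
  have -> : S (w *: x + y) - (w *: S x + S y) =
      (S (w *: x + y) - D (w *: x + y)) - w *: (S x - D x) - (S y - D y).
    by rewrite lD scalerBr -!addrA -!opprD addrACA !subrKC.
  rewrite (le_trans (rnormD _ _))// [leRHS]mulrDl; apply: lerD; last by rewrite rnormN; exact: hS.
  rewrite (le_trans (rnormD _ _))// [leRHS]mulrDl; apply: lerD; first exact: hS.
  by rewrite rnormN rnormZC -mulrA ler_wpM2l//; exact: hS.
have hD x : rnorm (S x - poly_operator (p 0%N) T x) <= 2 * rnorm x.
  by have := hS x 0%N; rewrite invr1 mulr1.
have bS : bounded_operator S.
  have [c c0 hc] := bounded_rnorm (bounded_poly_operator (p 0%N) bT).
  apply: (@bounded_operatorI _ _ (2 + c)) => // x.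
  rewrite -[S x](subrK (poly_operator (p 0%N) T x)) (le_trans (rnormD _ _))//.
  by rewrite mulrDl lerD.
exists S; apply/is_fun_calculusP; split=> // e e0.
have e2 : 0 < e / 2 by rewrite divr_gt0.
have [n /(_ n (leqnn n)) ne] := invS_le_epsilon e2.
exists (p n) => [r /Tab rab|x].
  by rewrite (le_trans (hp n _ rab))// (le_trans ne)// ler_pdivrMr// ler_pMr// ler1n.
rewrite rnormB (le_trans (hS x n))// mulrC mulrA ler_wpM2r ?rnorm_ge0//.
by rewrite -ler_pdivlMr.
Qed.

Lemma is_fun_calculusD f g T S S' : is_fun_calculus f T S -> is_fun_calculus g T S' ->
  is_fun_calculus (f \+ g) T (S + S').
Proof.
move=> /is_fun_calculusP[bS hS] /is_fun_calculusP[bS' hS'].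
apply/is_fun_calculusP; split=> [|e e0]; first exact: bounded_operatorD.
have e2 : 0 < e / 2 by rewrite divr_gt0.
have [p p1 p2] := hS _ e2; have [q q1 q2] := hS' _ e2.
exists (p + q) => [r sr|x].
  rewrite hornerD opprD addrACA (le_trans (ler_normD _ _))// [e]splitr.
  by rewrite lerD ?p1 ?q1.
rewrite poly_operatorD -[(S + S') x]/(S x + S' x) opprD addrACA [e]splitr mulrDl.
by rewrite (le_trans (rnormD _ _))// lerD.
Qed.

Lemma is_fun_calculusZ f c T S : is_fun_calculus f T S ->
  is_fun_calculus (c \*o f) T (c%:C *: S).
Proof.
move=> /is_fun_calculusP[bS hS].
apply/is_fun_calculusP; split=> [|e e0]; first exact: bounded_operatorZ.
have c1 : 0 < `|c| + 1 by rewrite ltr_wpDl.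
have ce : 0 < e / (`|c| + 1) by rewrite divr_gt0.
have h : `|c| * (e / (`|c| + 1)) <= e.
  by rewrite mulrA ler_pdivrMr// mulrC ler_pM2l// lerDl.
have [p p1 p2] := hS _ ce; exists (c *: p) => [r sr|x].
  rewrite hornerZ /= -mulrBr normrM (le_trans _ h)// ler_wpM2l//.
  exact: p1.
rewrite poly_operatorZ -[(_ *: S) x]/(c%:C *: S x) -scalerBr rnormZ.
rewrite (le_trans (ler_wpM2l _ (p2 x)))// mulrA ler_wpM2r ?rnorm_ge0//.
Qed.

Lemma is_fun_calculus_poly p T : bounded_operator T ->
  is_fun_calculus (horner p) T (poly_operator p T).
Proof.
move=> bT; apply/is_fun_calculusP; split=> [|e e0]; first exact: bounded_poly_operator.
exists p => [r _|x]; first by rewrite subrr normr0 ltW.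
by rewrite subrr rnorm0 mulr_ge0 ?rnorm_ge0// ltW.
Qed.

Lemma is_fun_calculusMX f c T S : bounded_operator T ->
  (forall r, spectrum T r%:C -> `|r| <= c) -> is_fun_calculus f T S ->
  is_fun_calculus (fun r => f r * r) T (S \o T).
Proof.
move=> bT hc /is_fun_calculusP[bS hS].
apply/is_fun_calculusP; split=> [|e e0]; first exact: bounded_operator_comp.
have [d d0 hd] := bounded_rnorm bT.
(* k dominates both |r| on the spectrum and the norm of T, so precision e / k serves the scalar and
   the operator estimate. *)
pose k := `|c| + d; have k0 : 0 < k by rewrite ltr_wpDl.
have ek : 0 < e / k by rewrite divr_gt0.
have [p p1 p2] := hS _ ek; exists (p * 'X) => [r sr|x].
  rewrite hornerM hornerX -mulrBl normrM -[leRHS](divfK (lt0r_neq0 k0)).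
  rewrite ler_pM ?p1// (le_trans (hc _ sr))// (le_trans (ler_norm c))// lerDl ltW//.
rewrite poly_operatorMX /= (le_trans (p2 _))// -[e in leRHS](divfK (lt0r_neq0 k0)) -[leRHS]mulrA.
rewrite ler_wpM2l ?(ltW ek)// (le_trans (hd _))// ler_wpM2r ?rnorm_ge0//.
by rewrite lerDr.
Qed.

(** If p is within e of f on the spectrum, p + e is nonnegative there, so p(T) + e is positive; S
    being within e of p(T), its form is at least -2 e |x|^2. *)
Lemma is_fun_calculus_ge0 f T S : bounded_operator T -> selfadjoint T ->
  is_fun_calculus f T S -> (forall r, spectrum T r%:C -> 0 <= f r) ->
  forall x, 0 <= rip (S x) x.
Proof.
move=> bT sT /is_fun_calculusP[bS hS] f0 x.
rewrite -oppr_le0; apply: (@le0_mul_epsilon _ (2 * rnorm x ^+ 2)).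
  by rewrite mulr_ge0// exprn_ge0// rnorm_ge0.
move=> e e0; have [p p1 p2] := hS _ e0.
have := @poly_operator_positive _ _ T (p + e%:P) bT sT _ x.
rewrite poly_operatorD poly_operatorC ripDl ripZl ripxx => h.
have {}h : 0 <= rip (poly_operator p T x) x + e * rnorm x ^+ 2.
  apply: h => r sr; rewrite hornerD hornerC; have := p1 r sr; have := f0 r sr.
  by rewrite ler_norml => ? /andP[? ?]; lra.
have := rip_le (ltW e0) (p2 x); rewrite ripBl; lra.
Qed.

Lemma is_fun_calculus_selfadjoint f T S : bounded_operator T -> selfadjoint T ->
  is_fun_calculus f T S -> selfadjoint S.
Proof.
move=> bT sT /is_fun_calculusP[bS hS]; apply: (rip_selfadjoint bS.1).
suff h x y : rip (S x) y - rip x (S y) <= 0.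
  move=> x y; have := h x y; have := h y x; rewrite (ripC (S y)) (ripC y).
  by move=> ? ?; apply/le_anti; lra.
apply: (@le0_mul_epsilon _ (2 * (rnorm x * rnorm y))).
  by rewrite !mulr_ge0 ?rnorm_ge0.
move=> e e0; have [p _ p2] := hS _ e0.
have h1 := rip_le_rnormM (S x - poly_operator p T x) y.
have h2 := rip_le_rnormM (poly_operator p T y - S y) x.
have h3 : rnorm (S x - poly_operator p T x) * rnorm y <= e * rnorm x * rnorm y.
  by rewrite ler_wpM2r ?rnorm_ge0// rnormB p2.
have h4 : rnorm (poly_operator p T y - S y) * rnorm x <= e * rnorm y * rnorm x.
  by rewrite ler_wpM2r ?rnorm_ge0// p2.
move: h1 h2; rewrite !ripBl.
rewrite (selfadjoint_rip x y (selfadjoint_poly_operator p bT.1 sT)).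
by rewrite (ripC x) (ripC x); lra.
Qed.

End FunctionalCalculus.

(** * Differentiable convex functions *)

Lemma interval_between (R : realType) (J : interval R) (a b y : R) :
  a \in J -> b \in J -> a <= y <= b -> y \in J.
Proof. by move=> aJ bJ; exact: (@interval_is_interval R J a b aJ bJ). Qed.

Section ConvexFunctions.
Context {R : realType}.
Variables (J : interval R) (f : R -> R) (hf : C1co J f).
Implicit Types (a b e s t x y z : R).

Local Notation f' := (derivative_on J f).

Let convexJ s t u : s \in J -> t \in J -> 0 <= u <= 1 ->
  f ((1 - u) * s + u * t) <= (1 - u) * f s + u * f t.
Proof.
move=> sJ tJ /andP[u0 u1].
have := hf.2 (Itv01 u0 u1); move=> /(_ t s); rewrite !inE => /(_ tJ sJ).
by rewrite addrC [leRHS]addrC.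
Qed.

Lemma derivative_onP t e : t \in J -> 0 < e -> exists2 d, 0 < d &
  forall y, y \in J -> `|y - t| < d -> `|f y - f t - f' t * (y - t)| <= e * `|y - t|.
Proof.
move=> tJ e0; have := (cvgrPdist_lt _ _).1 (hf.1 t tJ) _ e0.
have FJ : Filter (within [set` J] t^') by exact: within_filter.
rewrite !near_withinE /= => /(_ FJ)/nbhs_ballP[d /= d0 hd].
exists d => // y yJ ytd; have [->|yt] := eqVneq y t.
  by rewrite !subrr mulr0 subr0 normr0 mulr0.
have yt0 : y - t != 0 by rewrite subr_eq0.
have := hd y; rewrite /ball /= distrC => /(_ ytd yt yJ).
have -> : f y - f t = diff_quotient f t y * (y - t) by rewrite /diff_quotient divfK.
by rewrite -mulrBl normrM distrC => /ltW; apply: ler_wpM2r.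
Qed.

(** At the point t + u (s - t), convexity bounds f above by the chord and differentiability bounds
    it below by the tangent up to e u |s - t|; divide by u and let e vanish. *)
Lemma gradient_inequality s t : s \in J -> t \in J -> f t + f' t * (s - t) <= f s.
Proof.
move=> sJ tJ; rewrite -subr_le0; apply: (@le0_mul_epsilon _ `|s - t|) => // e e0.
have [d d0 hd] := derivative_onP tJ e0.
have c0 : 0 < `|s - t| + d by rewrite ltr_wpDl.
(* This weight satisfies 0 < u <= 1 and u |s - t| < d, also when s = t. *)
pose u := d / (`|s - t| + d) / 2.
have u0 : 0 < u by rewrite !divr_gt0.
have u1 : u <= 1.
  rewrite /u ler_pdivrMr// ler_pdivrMr// mul1r; have := normr_ge0 (s - t); lra.
have uJ : (1 - u) * t + u * s \in J.
  have [st|st] := leP t s.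
    apply: (interval_between tJ sJ).
    have : 0 <= u * (s - t) by rewrite mulr_ge0 ?subr_ge0// ltW.
    have : 0 <= (1 - u) * (s - t) by rewrite mulr_ge0 ?subr_ge0.
    by move=> ? ?; apply/andP; split; lra.
  apply: (interval_between sJ tJ).
  have : 0 <= u * (t - s) by rewrite mulr_ge0 ?subr_ge0 ?ltW.
  have : 0 <= (1 - u) * (t - s) by rewrite mulr_ge0 ?subr_ge0 ?(ltW st).
  by move=> ? ?; apply/andP; split; lra.
have yE : (1 - u) * t + u * s - t = u * (s - t) by ring.
have := hd _ uJ; rewrite yE normrM (gtr0_norm u0).
have ud : u * `|s - t| < d.
  rewrite /u mulrAC ltr_pdivrMr// mulrAC ltr_pdivrMr//.
  rewrite -mulrA ltr_pM2l//; have := normr_ge0 (s - t); lra.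
move=> /(_ ud); rewrite ler_norml => /andP[h1 _].
have := @convexJ t s u tJ sJ; rewrite (ltW u0) u1 => /(_ isT) h2.
rewrite -(ler_pM2l u0); move: h1 h2; lra.
Qed.

Lemma derivative_on_monotone s t : s \in J -> t \in J -> 0 <= (f' s - f' t) * (s - t).
Proof.
by move=> sJ tJ; have := gradient_inequality sJ tJ; have := gradient_inequality tJ sJ; lra.
Qed.

(** Let w = x + 2 (y - x) be the reflection of x in y. The gradient inequalities from y to w and
    from x to y give (f' y - f' x) (y - x) <= f w - f x - 2 f' x (y - x), which differentiability at
    x bounds by e |y - x|; monotonicity makes the left side nonnegative. *)
Lemma derivative_on_continuous a b x e : a \in J -> b \in J -> a <= x <= b -> 0 < e ->
  exists2 d, 0 < d & forall y, a <= y <= b -> `|y - x| < d -> `|f' y - f' x| <= e.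
Proof.
move=> aJ bJ /andP[ax xb] e0.
have inJ y : a <= y <= b -> y \in J by exact: interval_between.
have xJ : x \in J by rewrite inJ// ax.
have e2 : 0 < e / 2 by rewrite divr_gt0.
have [d d0 hd] := derivative_onP xJ e2.
(* These radii keep w in [a, b]. If x is an end, no y of [a, b] lies beyond it, and 1 is a harmless
   default. *)
pose d1 := if x < b then (b - x) / 2 else 1; pose d2 := if a < x then (x - a) / 2 else 1.
have d10 : 0 < d1 by rewrite /d1; case: ifP => // ?; rewrite divr_gt0// subr_gt0.
have d20 : 0 < d2 by rewrite /d2; case: ifP => // ?; rewrite divr_gt0// subr_gt0.
exists (Num.min (d / 2) (Num.min d1 d2)); first by rewrite !lt_min d10 d20 divr_gt0.
move=> y yab; rewrite !lt_min => /and3P[yd yd1 yd2]; have yJ := inJ _ yab.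
have wab : a <= x + 2 * (y - x) <= b.
  case/andP: yab => ay yb; have [yx|yx] := leP y x.
    move: yd2; rewrite ler0_norm ?subr_le0// /d2.
    have [?|xa] := ltP a x => h; first by apply/andP; split; lra.
    have : y = x by apply/le_anti; rewrite yx (le_trans xa).
    by move=> ->; rewrite subrr mulr0 addr0 ax.
  move: yd1; rewrite gtr0_norm ?subr_gt0// /d1.
  have [?|bx] := ltP x b => h; first by apply/andP; split; lra.
  by move: (lt_le_trans yx yb); rewrite ltNge bx.
have wJ := inJ _ wab; have wx : x + 2 * (y - x) - x = 2 * (y - x) by ring.
have [->|yx] := eqVneq y x; first by rewrite subrr normr0 ltW.
have yx0 : 0 < `|y - x| by rewrite normr_gt0 subr_eq0.
rewrite -(ler_pM2r yx0) -normrM ger0_norm; last exact: derivative_on_monotone.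
have := hd _ wJ; rewrite wx normrM (gtr0_norm (ltr0n _ 2)).
have -> : 2 * `|y - x| < d by lra.
move=> /(_ isT); rewrite ler_norml => /andP[_ h1].
have := gradient_inequality wJ yJ; have := gradient_inequality yJ xJ; lra.
Qed.

Lemma derivative_on_bounded a b x : a \in J -> b \in J -> a <= x <= b ->
  `|f' x| <= `|f' a| + `|f' b|.
Proof.
move=> aJ bJ /andP[ax xb].
have inJ y : a <= y <= b -> y \in J by exact: interval_between.
have [<-|nax] := eqVneq a x; first by rewrite lerDl.
have [->|nxb] := eqVneq x b; first by rewrite lerDr.
have ltax : a < x by rewrite lt_neqAle nax.
have ltxb : x < b by rewrite lt_neqAle nxb.
have xJ : x \in J by rewrite inJ// ax.
have := derivative_on_monotone xJ aJ; have := derivative_on_monotone bJ xJ.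
rewrite !pmulr_lge0 ?subr_gt0// !subr_ge0 => h1 h2.
rewrite ler_norml; have := ler_norm (f' b); have := lerNnormlW (lexx `|f' a|); have := normr_ge0 (f' b).
have := normr_ge0 (f' a); move=> *; apply/andP; split; lra.
Qed.

Lemma derivative_on_quadratic_modulus a b : a \in J -> b \in J ->
  quadratic_modulus a b f'.
Proof.
move=> aJ bJ; apply: (@continuous_quadratic_modulus _ _ _ _ (`|f' a| + `|f' b|)).
  by move=> x; exact: derivative_on_bounded.
by move=> x e; exact: derivative_on_continuous.
Qed.

Lemma C1co_quadratic_modulus a b : a \in J -> b \in J -> quadratic_modulus a b f.
Proof.
move=> aJ bJ; apply: (@lipschitz_quadratic_modulus _ _ _ _ (`|f' a| + `|f' b|)).
have inJ y : a <= y <= b -> y \in J by exact: interval_between.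
suff h x y : a <= x <= b -> a <= y <= b -> f x - f y <= (`|f' a| + `|f' b|) * `|x - y|.
  by move=> x y xab yab; rewrite ler_norml h// andbT lerNl opprB distrC h.
move=> xab yab; have := gradient_inequality (inJ _ yab) (inJ _ xab).
have : - (f' x * (y - x)) <= `|f' x| * `|x - y|.
  by rewrite -mulrN opprB -normrM ler_norm.
have : `|f' x| * `|x - y| <= (`|f' a| + `|f' b|) * `|x - y|.
  by rewrite ler_wpM2r// derivative_on_bounded.
by lra.
Qed.

End ConvexFunctions.

(** * Operator inequalities *)

(** The ends are themselves spectral values, so J contains the compact interval [a, b] even when J
    is open or unbounded, and with it every <T x, x> at unit x. *)
Lemma spectrum_range (R : realType) (H : hilbertType R) (T : H -> H) (J : interval R) :
  bounded_operator T -> selfadjoint T ->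
  spectrum T `<=` [set r%:C | r in [set` J]] -> (exists u : H, rnorm u = 1) ->
  exists a b, [/\ a \in J, b \in J, a <= b,
    forall r, spectrum T r%:C -> a <= r <= b &
    forall x, rnorm x = 1 -> a <= rip (T x) x <= b].
Proof.
move=> bT sT specT u1; have [a [b [sa sb sab qab]]] := spectrum_bounds bT sT u1.
have inJ r : spectrum T r%:C -> r \in J by move=> /specT[s sJ /complexI <-].
exists a, b; split; rewrite ?inJ//; first by case/andP: (sab _ sa).
by move=> x x1; have := qab x; rewrite x1 expr1n !mulr1.
Qed.

Section C1coCalculus.
Context {R : realType} {H : hilbertType R}.
Variables (T : H -> H) (J : interval R) (f : R -> R).
Hypotheses (bT : bounded_operator T) (sT : selfadjoint T).
Hypotheses (specT : spectrum T `<=` [set r%:C | r in [set` J]]) (hf : C1co J f).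
Hypothesis u1 : exists u : H, rnorm u = 1.
Implicit Types (x : H) (s : R).

Local Notation f' := (derivative_on J f).
Local Notation fT := (fun_calculus f T).
Local Notation f'T := (fun_calculus f' T).

Let inJ r : spectrum T r%:C -> r \in J.
Proof. by move=> /specT[s sJ /complexI <-]. Qed.

Lemma C1co_calculus : is_fun_calculus f T fT.
Proof.
have [a [b [aJ bJ ab sab _]]] := spectrum_range bT sT specT u1.
exact: (fun_calculusP bT sT ab sab (C1co_quadratic_modulus hf aJ bJ)).
Qed.

Lemma C1co_derivative_calculus : is_fun_calculus f' T f'T.
Proof.
have [a [b [aJ bJ ab sab _]]] := spectrum_range bT sT specT u1.
exact: (fun_calculusP bT sT ab sab (derivative_on_quadratic_modulus hf aJ bJ)).
Qed.

Lemma C1co_derivativeMX_calculus : is_fun_calculus (fun r => f' r * r) T (f'T \o T).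
Proof.
have [a [b [_ _ _ sab _]]] := spectrum_range bT sT specT u1.
apply: (@is_fun_calculusMX _ _ _ (`|a| + `|b|) _ _ bT _ C1co_derivative_calculus).
move=> r /sab /andP[ar rb]; rewrite ler_norml.
have := ler_norm b; have := ler_norm (- a); rewrite normrN.
by have := normr_ge0 b; have := normr_ge0 a; move=> *; apply/andP; split; lra.
Qed.

Lemma jensen_operator x : rnorm x = 1 -> f (rip (T x) x) <= rip (fT x) x.
Proof.
move=> x1; have [a [b [aJ bJ _ _ /(_ x x1) sx]]] := spectrum_range bT sT specT u1.
set s := rip (T x) x; have sJ : s \in J := interval_between aJ bJ sx.
(* The tangent of f at s: it lies below f, and p(T) has the value f s at x because <T x, x> = s. *)
pose p := (f s - f' s * s)%:P + f' s *: 'X.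
have := is_fun_calculus_ge0 bT sT (is_fun_calculusD C1co_calculus
  (is_fun_calculusZ (-1) (is_fun_calculus_poly p bT))).
move=> /(_ _ x); rewrite -[(_ + _) x]/(fT x + (-1)%:C *: poly_operator p T x).
rewrite poly_operatorD poly_operatorC poly_operatorZ poly_operatorX.
rewrite ripDl ripZl ripDl !ripZl ripxx x1 -/s => h.
have {}h := h _; rewrite -subr_ge0.
have -> : rip (fT x) x - f s = rip (fT x) x + -1 * ((f s - f' s * s) * 1 ^+ 2 + f' s * s).
  by ring.
apply: h => r /inJ rJ; rewrite /= hornerD hornerC hornerZ hornerX.
by have := gradient_inequality hf rJ sJ; lra.
Qed.

Lemma gradient_operator x s : s \in J -> rnorm x = 1 ->
  rip (fT x) x <= f s + (rip (f'T (T x)) x - s * rip (f'T x) x).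
Proof.
move=> sJ x1.
have := is_fun_calculus_ge0 bT sT (is_fun_calculusD
  (is_fun_calculusD (is_fun_calculus_poly (f s)%:P bT)
                    (is_fun_calculusZ (-1) C1co_calculus))
  (is_fun_calculusD (is_fun_calculusZ (- s) C1co_derivative_calculus)
                    C1co_derivativeMX_calculus)).
move=> /(_ _ x); rewrite -[(_ + _) x]/(poly_operator (f s)%:P T x + (-1)%:C *: fT x
  + ((- s)%:C *: f'T x + f'T (T x))).
rewrite poly_operatorC !ripDl !ripZl ripxx x1 => h.
rewrite -subr_ge0.
have -> : f s + (rip (f'T (T x)) x - s * rip (f'T x) x) - rip (fT x) x =
   f s * 1 ^+ 2 + -1 * rip (fT x) x + (- s * rip (f'T x) x + rip (f'T (T x)) x) by ring.
apply: h => r /inJ rJ; rewrite /= hornerC.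
by have := gradient_inequality hf sJ rJ; lra.
Qed.

(** Chebyshev's inequality: integrate (f' r - f' s) (r - s) >= 0 in r. With s = <T x, x>, the part -
    f' s (r - s), which is p below, has mean zero. *)
Lemma derivative_operator_covariance x : rnorm x = 1 ->
  rip (T x) x * rip (f'T x) x <= rip (f'T (T x)) x.
Proof.
move=> x1; have [a [b [aJ bJ _ _ /(_ x x1) sx]]] := spectrum_range bT sT specT u1.
set s := rip (T x) x; have sJ : s \in J := interval_between aJ bJ sx.
pose p := (f' s * s)%:P + (- f' s) *: 'X.
have := is_fun_calculus_ge0 bT sT (is_fun_calculusD (is_fun_calculus_poly p bT)
  (is_fun_calculusD (is_fun_calculusZ (- s) C1co_derivative_calculus)
                    C1co_derivativeMX_calculus)).
move=> /(_ _ x); rewrite -[(_ + _) x]/(poly_operator p T x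
  + ((- s)%:C *: f'T x + f'T (T x))).
rewrite poly_operatorD poly_operatorC poly_operatorZ poly_operatorX.
rewrite !ripDl !ripZl ripxx x1 -/s => h.
rewrite -subr_ge0.
have -> : rip (f'T (T x)) x - s * rip (f'T x) x =
   f' s * s * 1 ^+ 2 + - f' s * s + (- s * rip (f'T x) x + rip (f'T (T x)) x) by ring.
apply: h => r /inJ rJ; rewrite /= hornerD hornerC hornerZ hornerX.
by have := derivative_on_monotone hf rJ sJ; lra.
Qed.

Lemma derivative_operator_ge0 x : increasing_on J f -> 0 <= rip (f'T x) x.
Proof.
move=> fi; apply: (is_fun_calculus_ge0 bT sT C1co_derivative_calculus) => r /inJ.
exact: fi.
Qed.

End C1coCalculus.

Theorem corollary2p5 (R : realType) (H : hilbertType R) (A B : H -> H)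
    (J : interval R) (f : R -> R)
    (bA : bounded_operator A) (bB : bounded_operator B)
    (sA : selfadjoint A) (sB : selfadjoint B)
    (specA : spectrum A `<=` [set r%:C | r in [set` J]])
    (specB : spectrum B `<=` [set r%:C | r in [set` J]])
    (hf : C1co J f) (AB : operator_le A B) (f_incr : increasing_on J f) :
  let f'B := fun_calculus (derivative_on J f) B in
  let gamma : R := sup [set complex.Re (inner (f'B (B x)) x
                                        - inner (A x) x * inner (f'B x) x)
                       | x in [set x : H | `|x| = 1]] in
  0 <= gamma /\
  operator_le (fun_calculus f B) (fun_calculus f A + gamma%:C *: idfun).
Proof.
move=> f'B gamma.
have unitE x : `|x| = 1 <-> rnorm x = 1.
  by rewrite normE; split => [/complexI//|->].
(* In the zero space gamma is the supremum of the empty set, which is 0 by convention, and both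
   claims are trivial. *)
have [[u u1]|no_unit] := pselect (exists u : H, rnorm u = 1); last first.
  rewrite /gamma (_ : [set _ | _ in _] = set0) ?sup0; last first.
    by apply/seteqP; split=> // t [x /unitE x1 _]; apply: no_unit; exists x.
  split=> // x; have -> : x = 0.
    by apply: contra_notP no_unit => /eqP; exact: unit_vector_exists.
  by rewrite linear0r.
have ex_unit : exists u : H, rnorm u = 1 by exists u.
pose g x := rip (f'B (B x)) x - rip (A x) x * rip (f'B x) x.
have gE x : complex.Re (inner (f'B (B x)) x - inner (A x) x * inner (f'B x) x) = g x.
  by rewrite selfadjoint_innerE// raddfB; congr (_ - _); exact: Re_realM.
have [a [b [aJ bJ _ _ rangeA]]] := spectrum_range bA sA specA ex_unit.
have [bf'B _] := C1co_derivative_calculus bB sB specB hf ex_unit.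
(* Boundedness makes [sup] a genuine upper bound; <A x, x> is controlled by the spectral ends a and
   b. *)
have g_ub : has_ubound [set complex.Re (inner (f'B (B x)) x
                                        - inner (A x) x * inner (f'B x) x)
                       | x in [set x : H | `|x| = 1]].
  have [c c0 hc] := bounded_rnorm bf'B.
  have [d d0 hd] := bounded_rnorm (bounded_operator_comp bf'B bB).
  exists (d + (`|a| + `|b|) * c) => _ [x /unitE x1 <-]; rewrite gE /g.
  have := rip_le (ltW d0) (hd x); rewrite /= x1 expr1n mulr1 => h1.
  have := rip_abs_le (ltW c0) (hc x); rewrite x1 expr1n mulr1 => h2.
  rewrite lerD// -mulrN (le_trans (ler_norm _))// normrM normrN ler_pM//.
  have /andP[ax xb] := rangeA x x1; rewrite ler_norml.
  have := ler_norm b; have := ler_norm (- a); rewrite normrN.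
  by have := normr_ge0 b; have := normr_ge0 a; move=> *; apply/andP; split; lra.
have g_le x : rnorm x = 1 -> g x <= gamma.
  by move=> x1; apply: (ub_le_sup g_ub); exists x; [exact/unitE | exact: gE].
have AleB x : rip (A x) x <= rip (B x) x.
  have := AB x; rewrite lecE => /andP[_].
  by rewrite -/(rip ((B - A) x) x) ripBl subr_ge0.
split.
  apply: le_trans (g_le u u1); rewrite subr_ge0.
  apply: le_trans (derivative_operator_covariance bB sB specB hf ex_unit u1).
  by rewrite ler_wpM2r// (derivative_operator_ge0 bB sB specB hf).
have cA := C1co_calculus bA sA specA hf ex_unit.
have cB := C1co_calculus bB sB specB hf ex_unit.
set fA := fun_calculus f A in cA *; set fB := fun_calculus f B in cB *.
rewrite /operator_le; set D := _ - fB.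
have DE x : D x = fA x + gamma%:C *: x - fB x by [].
have bD : bounded_operator D.
  rewrite /D -scaleN1r; apply: bounded_operatorD; last exact/bounded_operatorZ/cB.1.
  exact: (bounded_operatorD cA.1 (bounded_operatorZ _ bounded_operator_id)).
(* [positive_operator] asks for a real nonnegative complex number; self-adjointness reduces it to
   the real form [rip]. *)
have sD : selfadjoint D.
  apply: (rip_selfadjoint bD.1) => x y.
  rewrite !DE !ripBl !ripBr !ripDl !ripDr !ripZl !ripZr.
  rewrite (selfadjoint_rip _ _ (is_fun_calculus_selfadjoint bA sA cA)).
  by rewrite (selfadjoint_rip _ _ (is_fun_calculus_selfadjoint bB sB cB)).
move=> x; rewrite selfadjoint_innerE// ler0c.
have := @rip_quadratic_lower _ _ D 0 bD.1 _ x; rewrite mul0r; apply=> {}x x1.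
rewrite DE ripBl ripDl ripZl ripxx x1 expr1n mulr1.
have sJ : rip (A x) x \in J := interval_between aJ bJ (rangeA x x1).
have h1 := jensen_operator bA sA specA hf ex_unit x1.
have h2 := gradient_operator bB sB specB hf ex_unit sJ x1.
by have := g_le x x1; rewrite /g; move: h1 h2; rewrite -/fA -/fB -/f'B; lra.
Qed.
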